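(* Let $h,n\in\mathbb{N}$, $m=2h$. Let $\{C(k)\}_{k>0}$ and $\{Q(k)\}_{k>0}$ be sequences of complex $h\times h$ matrices such that $$C(k)Q(k)^*=Q(k)C(k),\qquad C(k)>0\qquad (k>0).$$ Let $A$ and $S_0>0$ be complex $n\times n$ matrices and $\Pi_0$ a complex $n\times m$ matrix such that $$AS_0-S_0A^*=\mathrm{i}\,\Pi_0\, j\,\Pi_0^*\qquad\text{and}\qquad \begin{bmatrix}I_h&0\end{bmatrix}\Pi_0^*S_0^{-1}=0.$$ Let $\widetilde C(k)$, $\widetilde Q(k)$, the block Jacobi matrix $\widetilde{\mathcal J}$, and the block vector $Y=\{y_k\}_{k\ge1}$ be constructed from these data as described in the context. Then the block vector function $$\Psi(t)=Y\mathrm{e}^{-\mathrm{i}tA}$$ satisfies the discrete dynamical Schrödinger system $$\mathrm{i}\left(\frac{\partial}{\partial t}\Psi\right)(t)=\widetilde{\mathcal J}\,\Psi(t).$$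
   Context: Notation: $I_h$ is the $h\times h$ identity matrix, $^*$ is conjugate transpose, $M>0$ means that $M$ is positive definite (Hermitian), powers $M^{\pm1/2}$ of positive definite matrices are the positive definite ones. The $m\times m$ matrices are ($m=2h$) $$j=\begin{bmatrix}0 & I_h \\ I_h & 0\end{bmatrix},\quad P=\begin{bmatrix}0 & 0 \\ 0 & I_h\end{bmatrix},\quad \xi(k)=\begin{bmatrix}-\mathrm{i}Q(k) & C(k) \\ C(k)^{-1} & 0\end{bmatrix},\quad \zeta(k)=\begin{bmatrix}0 & 0 \\ 0 & C(k)^{-1}\end{bmatrix}.$$ For $k>0$ define recursively $$\Pi_k=\Pi_{k-1}\xi(k)^{-1}-\mathrm{i}A\Pi_{k-1}P,\qquad S_k=S_{k-1}+\Pi_{k-1}\zeta(k)\Pi_{k-1}^*.$$ Since $S_0>0$ and $C(k)>0$, one has $S_k>0$ for all $k\ge0$. Put $X(k)=\{X_{ip}(k)\}_{i,p=1}^2=\Pi_k^*S_k^{-1}\Pi_k$ ($k\ge0$), with $h\times h$ blocks $X_{ip}(k)$, and for $k>0$ $$\widetilde C(k)=C(k)+X_{22}(k-1),\qquad \widetilde Q(k)=Q(k)+\mathrm{i}\big(X_{21}(k-1)-X_{21}(k)\big).$$ Then $\widetilde C(k)>0$. The semi-infinite block Jacobi matrix $\widetilde{\mathcal J}$ is block tridiagonal with $h\times h$ blocks: diagonal blocks $\widetilde b_k$ ($k\ge1$), blocks $\widetilde a_k$ in position $(k,k+1)$ ($k\ge1$), and blocks $\widetilde c_k=\widetilde a_{k-1}^*$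 in position $(k,k-1)$ ($k\ge2$), where $$\widetilde a_k=-\mathrm{i}\,\widetilde C(k)^{-1/2}\widetilde C(k+1)^{1/2},\qquad \widetilde b_k=\widetilde C(k)^{-1/2}\widetilde Q(k)\widetilde C(k)^{1/2}.$$ The block vector $Y=\{y_k\}_{k\ge1}$ has $h\times n$ blocks $$y_k=\begin{bmatrix}0&\widetilde C(k)^{-1/2}\end{bmatrix}\Pi_{k-1}^*S_{k-1}^{-1}.$$ Products of $\widetilde{\mathcal J}$ with block vectors are formal matrix products (each row is a finite sum), derivatives in $t$ are taken blockwise, and $t\in\mathbb{R}$. *)

(* Defs.v *)
From HB Require Import structures.
From mathcomp Require Import all_boot all_order all_algebra.
From mathcomp Require Import spectral sesquilinear complex.
From mathcomp Require Import all_classical all_reals all_analysis.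

Set Implicit Arguments.
Unset Strict Implicit.
Unset Printing Implicit Defensive.

Import Order.TTheory GRing.Theory Num.Theory.
Import numFieldNormedType.Exports.

Local Open Scope classical_set_scope.
Local Open Scope ring_scope.
Local Open Scope sesquilinear_scope.

Section PositiveDefinite.
Context {C : numClosedFieldType}.

(* [0 < z] in a [numClosedFieldType] entails that [z] is real. *)
Definition posdefmx n (M : 'M[C]_n) : Prop :=
  M \is hermsymmx /\
  forall u : 'cV[C]_n, u != 0 -> 0 < (u ^t* *m M *m u) ord0 ord0.

(* [0] is a junk value, taken only when [M] has no positive definite root. *)
Definition sqrtmx n (M : 'M[C]_n) : 'M[C]_n :=
  xget 0 [set B | posdefmx B /\ B *m B = M].

Definition invsqrtmx n (M : 'M[C]_n) : 'M[C]_n := invmx (sqrtmx M).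

End PositiveDefinite.

Section BlockJacobi.
Context {C : numClosedFieldType}.

(* Semi-infinite block matrices and block vectors have blocks numbered from 1;
   the blocks with an index 0 are never used. *)

Definition block_jacobi h (a b : nat -> 'M[C]_h) (k l : nat) : 'M[C]_h :=
  if l == k then b k
  else if l == k.+1 then a k
  else if k == l.+1 then (a l) ^t*
  else 0.

(* Every row of [J] is assumed to have finitely many nonzero blocks, in which
   case the finitely supported sum is the usual one. *)
Definition block_mul h n (J : nat -> nat -> 'M[C]_h)
    (V : nat -> 'M[C]_(h, n)) (k : nat) : 'M[C]_(h, n) :=
  \sum_(l \in [set l : nat | (0 < l)%N]) (J k l *m V l).

End BlockJacobi.

Section BacklundDarboux.
Context {C : numClosedFieldType} {h n : nat}.

Definition jmx : 'M[C]_(h + h) := block_mx 0 1%:M 1%:M 0.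

Definition Pmx : 'M[C]_(h + h) := block_mx 0 0 0 1%:M.

(* The sequences [Ck] and [Qk] are only used at indices [k > 0]. *)
Context (Ck Qk : nat -> 'M[C]_h) (A S0 : 'M[C]_n) (Pi0 : 'M[C]_(n, h + h)).

Definition xi (k : nat) : 'M[C]_(h + h) :=
  block_mx (- 'i *: Qk k) (Ck k) (invmx (Ck k)) 0.

Definition zeta (k : nat) : 'M[C]_(h + h) := block_mx 0 0 0 (invmx (Ck k)).

Fixpoint Pi_ (k : nat) : 'M[C]_(n, h + h) :=
  if k is k'.+1 then Pi_ k' *m invmx (xi k'.+1) - 'i *: (A *m Pi_ k' *m Pmx)
  else Pi0.

Fixpoint S_ (k : nat) : 'M[C]_n :=
  if k is k'.+1 then S_ k' + Pi_ k' *m zeta k'.+1 *m (Pi_ k') ^t*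
  else S0.

Definition X_ (k : nat) : 'M[C]_(h + h) :=
  (Pi_ k) ^t* *m invmx (S_ k) *m Pi_ k.

Definition X21 (k : nat) : 'M[C]_h := dlsubmx (X_ k).

Definition X22 (k : nat) : 'M[C]_h := drsubmx (X_ k).

Definition tC (k : nat) : 'M[C]_h := Ck k + X22 k.-1.

Definition tQ (k : nat) : 'M[C]_h := Qk k + 'i *: (X21 k.-1 - X21 k).

Definition ta (k : nat) : 'M[C]_h :=
  - 'i *: (invsqrtmx (tC k) *m sqrtmx (tC k.+1)).

Definition tb (k : nat) : 'M[C]_h :=
  invsqrtmx (tC k) *m tQ k *m sqrtmx (tC k).

Definition tJ : nat -> nat -> 'M[C]_h := block_jacobi ta tb.

Definition Yvec (k : nat) : 'M[C]_(h, n) :=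
  row_mx 0 (invsqrtmx (tC k)) *m (Pi_ k.-1) ^t* *m invmx (S_ k.-1).

End BacklundDarboux.

Section ComplexAnalysis.
Context {R : realType}.

(* [R[i]] viewed as a [numClosedFieldType], which is how it gets its topology. *)
Definition Cplx (R : realType) : numClosedFieldType := R[i].

Definition expmx n (M : 'M[Cplx R]_n) : 'M[Cplx R]_n :=
  limn (series (fun k : nat => (k`!%:R)^-1 *: (M ^+ k))).

(* [derive] requires the scalars of the codomain to be the real numbers, hence
   these variants for matrix functions of a real variable, complex entries. *)
Definition diff_quot m n (F : R -> 'M[Cplx R]_(m, n)) (t s : R)
    : 'M[Cplx R]_(m, n) :=
  (s^-1)%:C%C *: (F (t + s) - F t).

Definition derivablemx m n (F : R -> 'M[Cplx R]_(m, n)) (t : R) : Prop :=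
  cvg (diff_quot F t s @[s --> 0^']).

Definition derivemx m n (F : R -> 'M[Cplx R]_(m, n)) (t : R)
    : 'M[Cplx R]_(m, n) :=
  lim (diff_quot F t s @[s --> 0^']).

End ComplexAnalysis.

(* Main.v *)
Require Import Defs.
From HB Require Import structures.
From mathcomp Require Import all_boot all_order all_algebra.
From mathcomp Require Import spectral sesquilinear complex.
From mathcomp Require Import ring zify.
From mathcomp Require Import all_classical all_reals all_analysis.

Set Implicit Arguments.
Unset Strict Implicit.
Unset Printing Implicit Defensive.

Import Order.TTheory GRing.Theory Num.Theory.
Import numFieldNormedType.Exports.

Local Open Scope classical_set_scope.
Local Open Scope ring_scope.
Local Open Scope sesquilinear_scope.

(** Since [Psi t = Y e^(-itA)], the system reduces to two facts: the matrix
    exponential has the derivative [(e^(tB))' = B e^(tB)], and [Y] intertwines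
    the transformed Jacobi matrix with [A], that is, [tJ Y = Y A].

    The intertwining relation comes from the Lyapunov identity
    [A S_k - S_k A^* = i Pi_k j Pi_k^*], which each step of the recursion
    preserves ([step_identity]).  Write [Pi_k = [a_k b_k]],
    [U_k = a_k^* S_k^-1] and [V_k = b_k^* S_k^-1], so that the blocks of [Y] are
    [y_(k+1) = tC(k+1)^(-1/2) V_k].  The first block column of the recursion
    gives [tC(k+1) U_(k+1) = V_k] ([step_left]); the second one, together with
    the identity for [S_k], gives
    [V_k A = tQ(k+1) V_k - i V_(k+1) + i tC(k+1) U_k] ([step_right]).
    Eliminating the [U_k] turns this into a three-term recurrence for the [V_k],
    and conjugation by the square roots of the [tC(k)] makes its coefficients
    the blocks of the transformed matrix ([block_mul_tJ]).  In the first row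
    there is no lower neighbour; the term [i tC(1) U_0] vanishes there because
    [U_0 = 0] is the assumption made on [Pi_0^* S_0^-1].

    For the exponential, the entries of [B^k] are bounded by a geometric
    sequence, so that the entries of [e^(tB)] have everywhere convergent
    exponential generating functions as real and imaginary parts.
    Differentiating such a function shifts its coefficient sequence
    ([egf_derive]), and shifting the powers of [B] is multiplication by [B]
    ([expmx_diff_quot]). *)

(** * Conjugate transposes and positive definite matrices *)

Section ConjugateTranspose.
Context {C : numClosedFieldType}.

Lemma adjmxM m n p (M : 'M[C]_(m, n)) (N : 'M[C]_(n, p)) :
  (M *m N)^t* = N^t* *m M^t*.
Proof. by rewrite trmx_mul map_mxM. Qed.

Lemma adjmxD m n (M N : 'M[C]_(m, n)) : (M + N)^t* = M^t* + N^t*.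
Proof. by rewrite linearD map_mxD. Qed.

Lemma adjmxN m n (M : 'M[C]_(m, n)) : (- M)^t* = - M^t*.
Proof. by rewrite linearN map_mxN. Qed.

Lemma adjmxZ m n (a : C) (M : 'M[C]_(m, n)) : (a *: M)^t* = a^* *: M^t*.
Proof. by rewrite linearZ map_mxZ. Qed.

Lemma adjmxV n (M : 'M[C]_n) : (invmx M)^t* = invmx (M^t*).
Proof. by rewrite trmx_inv map_invmx. Qed.

Lemma adj_row_mx m n1 n2 (M : 'M[C]_(m, n1)) (N : 'M[C]_(m, n2)) :
  (row_mx M N)^t* = col_mx (M^t*) (N^t*).
Proof. by rewrite tr_row_mx map_col_mx. Qed.

Lemma hermsymmxP n (M : 'M[C]_n) : reflect (M^t* = M) (M \is hermsymmx).
Proof.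
apply: (iffP (is_hermitianmxP _ _ _)); first by rewrite expr0 scale1r => <-.
by move=> MM; rewrite expr0 scale1r MM.
Qed.

End ConjugateTranspose.

Section PositiveDefinite.
Context {C : numClosedFieldType}.

Lemma posdefmx_adj n (M : 'M[C]_n) : posdefmx M -> M^t* = M.
Proof. by case=> /hermsymmxP. Qed.

Lemma posdefmx_ge0 n (M : 'M[C]_n) (u : 'cV[C]_n) : posdefmx M ->
  0 <= (u^t* *m M *m u) ord0 ord0.
Proof.
move=> [_ M0]; have [->|u0] := eqVneq u 0; last by rewrite ltW ?M0.
by rewrite mulmx0 mxE.
Qed.

Lemma posdefmx_unit n (M : 'M[C]_n) : posdefmx M -> M \in unitmx.
Proof.
move=> [_ M0]; rewrite -unitmx_tr -row_free_unit; apply: inj_row_free => v vM.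
apply: trmx_inj; rewrite trmx0; apply/eqP/negPn/negP => /M0.
by rewrite -mulmxA -[M *m _]trmxK trmx_mul trmxK vM trmx0 mulmx0 mxE ltxx.
Qed.

Lemma posdefmx_congr n (M P : 'M[C]_n) : posdefmx M -> P \in unitmx ->
  posdefmx (P^t* *m M *m P).
Proof.
move=> M0 Pu; split=> [|u u0].
  by apply/hermsymmxP; rewrite !adjmxM trmxCK (posdefmx_adj M0) mulmxA.
have -> : u^t* *m (P^t* *m M *m P) *m u = (P *m u)^t* *m M *m (P *m u).
  by rewrite adjmxM !mulmxA.
apply: M0.2; apply: contra u0 => /eqP Pu0.
by rewrite -[u](mulKmx Pu) Pu0 mulmx0.
Qed.

Lemma posdefmxV n (M : 'M[C]_n) : posdefmx M -> posdefmx (invmx M).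
Proof.
move=> M0; have Mu := posdefmx_unit M0.
have := posdefmx_congr M0 (_ : invmx M \in unitmx); rewrite unitmx_inv.
by move=> /(_ Mu); rewrite adjmxV (posdefmx_adj M0) mulVmx// mul1mx.
Qed.

(** The congruence term is only positive semidefinite, as [B] may be singular
    or rectangular, but it does not spoil the definiteness of [M]. *)
Lemma posdefmxD_congr n p (M : 'M[C]_n) (N : 'M[C]_p) (B : 'M[C]_(n, p)) :
  posdefmx M -> posdefmx N -> posdefmx (M + B *m N *m B^t*).
Proof.
move=> M0 N0; split=> [|u u0].
  by apply/hermsymmxP; rewrite adjmxD !adjmxM trmxCK (posdefmx_adj M0)
    (posdefmx_adj N0) mulmxA.
have -> : u^t* *m (M + B *m N *m B^t*) *m u =
    u^t* *m M *m u + (B^t* *m u)^t* *m N *m (B^t* *m u).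
  by rewrite adjmxM trmxCK mulmxDr mulmxDl !mulmxA.
by rewrite mxE ltr_wpDr ?posdefmx_ge0// M0.2.
Qed.

Lemma posdefmx_diag n (d : 'rV[C]_n) :
  posdefmx (diag_mx d) <-> forall i, 0 < d 0 i.
Proof.
split=> [[_ d0] i|d0].
  have /d0 : delta_mx i 0 != 0 :> 'cV[C]_n.
    apply/eqP => /matrixP/(_ i 0)/eqP.
    by rewrite !mxE !eqxx oner_eq0.
  rewrite -mulmxA mul_diag_mx mxE (bigD1 i)//= big1 ?addr0.
    by rewrite !mxE !eqxx conjC1 !mul1r mulr1.
  by move=> j ji; rewrite !mxE (negPf ji) conjC0 mul0r.
split=> [|u u0].
  apply/hermsymmxP; rewrite tr_diag_mx map_diag_mx; congr diag_mx.
  by apply/rowP => i; rewrite mxE; apply/CrealP/gtr0_real.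
have /existsP[i ui0] : [exists i, u i 0 != 0].
  apply: contraNT u0; rewrite negb_exists => /forallP u0.
  by apply/eqP/colP => i; rewrite mxE; apply/eqP/negPn.
have E j : (u^t*) 0 j * (diag_mx d *m u) j 0 = d 0 j * `|u j 0| ^+ 2.
  by rewrite mul_diag_mx !mxE normCK; ring.
rewrite -mulmxA mxE (bigD1 i)//= E ltr_wpDr//.
  by rewrite sumr_ge0// => j _; rewrite E mulr_ge0 ?exprn_ge0// ltW.
by rewrite mulr_gt0// exprn_gt0// normr_gt0.
Qed.

(** Take square roots of the eigenvalues in a unitary diagonalization. *)
Lemma posdefmx_sqrt n (M : 'M[C]_n) : posdefmx M ->
  exists B, posdefmx B /\ B *m B = M.
Proof.
move=> M0; have := hermitian_normalmx M0.1 => /orthomx_spectralP.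
set P := spectralmx M; set d := spectral_diag M => Mdef.
have Pu : P \in unitmx := spectral_unit M.
have PV : invmx P = P^t* by rewrite invmx_unitary// spectral_unitarymx.
have d0 i : 0 < d 0 i.
  move: i; apply/posdefmx_diag.
  have -> : diag_mx d = (invmx P)^t* *m M *m invmx P.
    by rewrite Mdef PV trmxCK -PV !mulmxA mulmxV// mul1mx mulmxK.
  by apply: posdefmx_congr; rewrite ?unitmx_inv.
pose D := diag_mx (\row_i sqrtC (d 0 i)).
have DD : D *m D = diag_mx d.
  rewrite mulmx_diag; congr diag_mx; apply/rowP => i.
  by rewrite !mxE -expr2 sqrtCK.
exists (P^t* *m D *m P); split.
  apply: posdefmx_congr => //; apply/posdefmx_diag => i.
  by rewrite mxE sqrtC_gt0.
by rewrite Mdef -DD PV -PV !mulmxA mulmxK.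
Qed.

Lemma sqrtmxP n (M : 'M[C]_n) : posdefmx M ->
  posdefmx (sqrtmx M) /\ sqrtmx M *m sqrtmx M = M.
Proof. by move=> M0; exact: (xgetPex 0 (posdefmx_sqrt M0)). Qed.

End PositiveDefinite.

(** * One step of the transformation *)

Section EntrywiseRing.
Context {C : comPzRingType} {m n : nat}.
Implicit Types (M N : 'M[C]_(m, n)).

Lemma entryD M N i j : (M + N) i j = M i j + N i j. Proof. exact: mxE. Qed.
Lemma entryN M i j : (- M) i j = - M i j. Proof. exact: mxE. Qed.
Lemma entryZ a M i j : (a *: M) i j = a * M i j. Proof. exact: mxE. Qed.

End EntrywiseRing.

(* Identities between linear combinations of matrix monomials, with the
   monomials as atoms. *)
Ltac mx_lincomb :=
  apply/matrixP => ? ?; rewrite !(entryD, entryN, entryZ); ring.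

(** Here [a] and [b] are the two block columns of the matrix [Pi_k], and [c] and
    [q] are the coefficients of index [k + 1]; primes mark the data of index
    [k + 1]. *)
Section Step.
Context {C : numClosedFieldType} {h n : nat}.
Context (A S : 'M[C]_n) (a b : 'M[C]_(n, h)) (c q : 'M[C]_h).
Hypothesis (cq : c *m q^t* = q *m c) (c_gt0 : posdefmx c) (S_gt0 : posdefmx S).
Hypothesis AS : A *m S - S *m A^t* = 'i *: (a *m b^t* + b *m a^t*).

Let a' := b *m invmx c.
Let b' := a *m c + 'i *: (b *m q^t*) - 'i *: (A *m b).
Let S' := S + b *m invmx c *m b^t*.

Let cu : c \in unitmx. Proof. exact: posdefmx_unit. Qed.
Let Su : S \in unitmx. Proof. exact: posdefmx_unit. Qed.

Lemma step_posdef : posdefmx S'.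
Proof. by apply: posdefmxD_congr => //; apply: posdefmxV. Qed.

Let S'u : S' \in unitmx. Proof. exact/posdefmx_unit/step_posdef. Qed.

Let a'_adj : a'^t* = invmx c *m b^t*.
Proof. by rewrite adjmxM adjmxV (posdefmx_adj c_gt0). Qed.

Let b'_adj : b'^t* = c *m a^t* - 'i *: (q *m b^t*) + 'i *: (b^t* *m A^t*).
Proof.
rewrite /b' !(adjmxD, adjmxN, adjmxZ, adjmxM) (posdefmx_adj c_gt0) trmxCK.
by rewrite conjCi !scaleNr opprK.
Qed.

(** The commutation relation [cq] makes the terms in [q] cancel, and the terms
    that [A] contributes through [b'] and its adjoint are the ones that [S' - S]
    produces on the left-hand side. *)
Lemma step_identity :
  A *m S' - S' *m A^t* = 'i *: (a' *m b'^t* + b' *m a'^t*).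
Proof.
have cq' : invmx c *m q = q^t* *m invmx c.
  by rewrite -[in LHS](mulmxK cu q) -cq mulmxA mulKmx.
have -> : A *m S' - S' *m A^t* = 'i *: (a *m b^t* + b *m a^t*)
    + A *m b *m invmx c *m b^t* - b *m invmx c *m b^t* *m A^t*.
  by rewrite -AS /S' mulmxDr mulmxDl !mulmxA; mx_lincomb.
rewrite a'_adj b'_adj /a' /b' !(mulmxDl, mulmxDr, mulmxN, mulNmx).
rewrite -!scalemxAl -!scalemxAr !mulmxA mulmxKV// mulmxK//.
rewrite -(mulmxA b _ q) cq' !mulmxA.
rewrite !(scalerDr, scalerN, scalerA) -expr2 sqrCi.
mx_lincomb.
Qed.

Let x21 := b^t* *m invmx S *m a.
Let x21' := b'^t* *m invmx S' *m a'.
Let x22 := b^t* *m invmx S *m b.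

(** A push-through identity: both sides become equal to
    [b^t* + x22 *m invmx c *m b^t*] after multiplication by [S'] on the
    right. *)
Lemma step_left : (c + x22) *m (a'^t* *m invmx S') = b^t* *m invmx S.
Proof.
rewrite mulmxA; suff -> : (c + x22) *m a'^t* = b^t* *m invmx S *m S'.
  by rewrite mulmxK.
by rewrite a'_adj mulmxDl mulmxDr !mulmxA mulmxKV// mulmxV// mul1mx.
Qed.

(** The recursion expresses [b^t* *m A^t*] by [b'^t*]; the change from [invmx S]
    to [invmx S'] in that term is what produces [x21']. *)
Lemma step_right : b^t* *m invmx S *m A =
  (q + 'i *: (x21 - x21')) *m (b^t* *m invmx S)
  - 'i *: (b'^t* *m invmx S') + 'i *: ((c + x22) *m (a^t* *m invmx S)).
Proof.
(* The Lyapunov identity moves [A] to the left of [invmx S]. *)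
have SA : invmx S *m A = A^t* *m invmx S +
    'i *: (invmx S *m (a *m b^t* + b *m a^t*) *m invmx S).
  apply: (canLR (mulKmx Su)).
  apply: (can_inj (mulmxK Su)).
  rewrite mulmxDr mulmxDl -scalemxAr -scalemxAl !mulmxA mulmxV// mul1mx.
  by rewrite !mulmxKV// -AS addrC subrK.
have b'S : b'^t* *m invmx S = b'^t* *m invmx S' + x21' *m (b^t* *m invmx S).
  rewrite -[in LHS](mulmxKV S'u (b'^t*)) -(mulmxA _ S') {2}/S' mulmxDl mulmxV//.
  by rewrite mulmxDr mulmx1 /x21' /a' !mulmxA.
have bA : b^t* *m A^t* = q *m b^t* + 'i *: (c *m a^t*) - 'i *: b'^t*.
  rewrite b'_adj !(scalerDr, scalerN, scalerA) -expr2 sqrCi.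
  mx_lincomb.
rewrite -(mulmxA (b^t*)) SA (mulmxDr (b^t*)) (mulmxA (b^t*)) bA.
rewrite !(mulmxDl, mulmxDr, mulmxN, mulNmx) -!scalemxAl -!scalemxAr.
rewrite b'S /x21 /x22 !(mulmxDl, mulmxDr, mulmxN, mulNmx, scalerDr) !mulmxA.
mx_lincomb.
Qed.

End Step.

(** * The transformed Jacobi matrix *)

(** The first row has only two terms: the adjoint of [aa 0] would multiply
    [W 0], and block vectors start at index 1. *)
Lemma block_mul_jacobi (C : numClosedFieldType) h p
    (aa bb : nat -> 'M[C]_h) (W : nat -> 'M[C]_(h, p)) k :
  block_mul (block_jacobi aa bb) W k.+1 =
  (if k is k'.+1 then (aa k)^t* *m W k else 0)
  + bb k.+1 *m W k.+1 + aa k.+1 *m W k.+2.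
Proof.
pose F l := block_jacobi aa bb k.+1 l *m W l.
pose r := [seq l <- [:: k; k.+1; k.+2] | (0 < l)%N].
have r_uniq : uniq r by rewrite filter_uniq//= !inE !negb_or; lia.
have r_pos : [set` r] `<=` [set l | (0 < l)%N].
  by move=> l /=; rewrite mem_filter => /andP[].
have F0 l : (0 < l)%N -> l \notin r -> F l = 0.
  move=> l0; rewrite mem_filter l0 /= !inE !negb_or => /and3P[lk lk1 lk2].
  rewrite /F /block_jacobi (negPf lk1) (negPf lk2) eqSS eq_sym (negPf lk).
  exact: mul0mx.
rewrite /block_mul (fsbigE r)//.
have Fk : F k = (aa k)^t* *m W k.
  by rewrite /F /block_jacobi !eqxx; do ! case: eqP => //; lia.
have Fk1 : F k.+1 = bb k.+1 *m W k.+1 by rewrite /F /block_jacobi eqxx.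
have Fk2 : F k.+2 = aa k.+1 *m W k.+2.
  by rewrite /F /block_jacobi eqxx; case: eqP => //; lia.
rewrite big_filter_cond (eq_bigl (fun l => (0 < l)%N)); last first.
  by move=> l; apply/andP/idP => [[]//|l0]; rewrite inE.
rewrite -Fk -Fk1 -Fk2 (eq_bigr F)//.
by case: (k) => [|k1]; rewrite !big_cons big_nil /= ?add0r addr0 ?addrA.
Qed.

Lemma block_mul_jacobi_mulmx (C : numClosedFieldType) h p q
    (aa bb : nat -> 'M[C]_h) (W : nat -> 'M[C]_(h, p)) (M : 'M[C]_(p, q)) k :
  (0 < k)%N -> block_mul (block_jacobi aa bb) (fun l => W l *m M) k =
  block_mul (block_jacobi aa bb) W k *m M.
Proof.
case: k => // k _; rewrite !block_mul_jacobi !mulmxDl !mulmxA.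
by case: k => [|k]; rewrite ?mul0mx ?mulmxA.
Qed.

Section Transformed.
Context {C : numClosedFieldType} {h n : nat}.
Context (Ck Qk : nat -> 'M[C]_h) (A S0 : 'M[C]_n) (Pi0 : 'M[C]_(n, h + h)).
Hypothesis CkQk : forall k, (0 < k)%N -> Ck k *m (Qk k)^t* = Qk k *m Ck k.
Hypothesis Ck_gt0 : forall k, (0 < k)%N -> posdefmx (Ck k).
Hypothesis S0_gt0 : posdefmx S0.
Hypothesis AS0 : A *m S0 - S0 *m A^t* = 'i *: (Pi0 *m jmx *m Pi0^t*).

Let Pi := Pi_ Ck Qk A Pi0.
Let S := S_ Ck Qk A S0 Pi0.
Let a k := lsubmx (Pi k).
Let b k := rsubmx (Pi k).

Let PiE k : Pi k = row_mx (a k) (b k). Proof. by rewrite hsubmxK. Qed.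

Let Pi_adj k : (Pi k)^t* = col_mx ((a k)^t*) ((b k)^t*).
Proof. by rewrite PiE adj_row_mx. Qed.

Lemma invmx_xi k : (0 < k)%N -> invmx (xi Ck Qk k) =
  block_mx 0 (Ck k) (invmx (Ck k)) ('i *: (Qk k)^t*).
Proof.
move=> k0; have cu := posdefmx_unit (Ck_gt0 k0); set N := RHS.
have xiN : xi Ck Qk k *m N = 1%:M.
  rewrite /xi mulmx_block !mulmx0 !mul0mx !add0r !addr0 mulmxV// mulVmx//.
  rewrite -scalemxAl -scalemxAr CkQk// -scalerDl addNr scale0r.
  by rewrite -scalar_mx_block.
by have [xiu _] := mulmx1_unit xiN; rewrite -[N](mulKmx xiu) xiN mulmx1.
Qed.

Let PiS k : Pi k.+1 = row_mx (b k *m invmx (Ck k.+1))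
  (a k *m Ck k.+1 + 'i *: (b k *m (Qk k.+1)^t*) - 'i *: (A *m b k)).
Proof.
rewrite [LHS]/= -/(Pi k) invmx_xi// /Pmx -mulmxA PiE.
rewrite !mul_row_block !mulmx0 !add0r mulmx1 mul_mx_row mulmx0.
by rewrite scale_row_mx scaler0 opp_row_mx oppr0 add_row_mx addr0 -scalemxAr.
Qed.

Let aS k : a k.+1 = b k *m invmx (Ck k.+1).
Proof. by rewrite /a PiS row_mxKl. Qed.

Let bS k : b k.+1 =
  a k *m Ck k.+1 + 'i *: (b k *m (Qk k.+1)^t*) - 'i *: (A *m b k).
Proof. by rewrite /b PiS row_mxKr. Qed.

Let SS k : S k.+1 = S k + b k *m invmx (Ck k.+1) *m (b k)^t*.
Proof.
rewrite [LHS]/= -/(Pi k) -/(S k) Pi_adj PiE /zeta mul_row_block.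
by rewrite !mulmx0 !add0r mul_row_col mul0mx add0r.
Qed.

Lemma S_gt0 k : posdefmx (S k).
Proof.
elim: k => [|k IH]; first exact: S0_gt0.
by rewrite SS; apply: step_posdef => //; exact: Ck_gt0.
Qed.

Lemma S_identity k :
  A *m S k - S k *m A^t* = 'i *: (a k *m (b k)^t* + b k *m (a k)^t*).
Proof.
elim: k => [|k IH].
  rewrite /S /= AS0 -[Pi0]/(Pi 0) Pi_adj PiE /jmx mul_row_block.
  by rewrite !mulmx0 !mulmx1 add0r addr0 mul_row_col addrC.
rewrite SS aS bS.
exact: step_identity (CkQk (ltn0Sn k)) (Ck_gt0 (ltn0Sn k)) IH.
Qed.

Let X21E k : X21 Ck Qk A S0 Pi0 k = (b k)^t* *m invmx (S k) *m a k.
Proof.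
rewrite /X21 /X_ -/(Pi k) -/(S k) Pi_adj PiE mul_col_mx mul_col_row.
exact: block_mxKdl.
Qed.

Let X22E k : X22 Ck Qk A S0 Pi0 k = (b k)^t* *m invmx (S k) *m b k.
Proof.
rewrite /X22 /X_ -/(Pi k) -/(S k) Pi_adj PiE mul_col_mx mul_col_row.
exact: block_mxKdr.
Qed.

Let c := tC Ck Qk A S0 Pi0.

Lemma tC_gt0 k : (0 < k)%N -> posdefmx (c k).
Proof.
case: k => // k _; rewrite /c /tC X22E /=.
rewrite -{2}[b k]trmxCK; apply: posdefmxD_congr; first exact: Ck_gt0.
exact/posdefmxV/S_gt0.
Qed.

Let y := Yvec Ck Qk A S0 Pi0.
Let U k := (a k)^t* *m invmx (S k).
Let V k := (b k)^t* *m invmx (S k).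

Let yE k : y k.+1 = invsqrtmx (c k.+1) *m V k.
Proof.
rewrite /y /Yvec -/(c k.+1) /= -/(Pi k) -/(S k) Pi_adj mul_row_col mul0mx add0r.
by rewrite mulmxA.
Qed.

Let cU k : c k.+1 *m U k.+1 = V k.
Proof.
rewrite /c /tC X22E /U /V SS aS; exact: step_left (Ck_gt0 (ltn0Sn k)) (S_gt0 k).
Qed.

Let VA k : V k *m A = tQ Ck Qk A S0 Pi0 k.+1 *m V k - 'i *: V k.+1
  + 'i *: (c k.+1 *m U k).
Proof.
rewrite /c /tC /tQ !X21E X22E /U /V SS aS bS.
by apply: step_right; [exact: Ck_gt0|exact: S_gt0|exact: S_identity].
Qed.

Hypothesis Pi0_S0 : row_mx 1%:M (0 : 'M[C]_h) *m Pi0^t* *m invmx S0 = 0.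

Let U0 : U 0 = 0.
Proof.
rewrite -[RHS]Pi0_S0 -[Pi0]/(Pi 0) Pi_adj mul_row_col mul1mx mul0mx addr0.
exact: erefl.
Qed.

Lemma block_mul_tJ k : (0 < k)%N ->
  block_mul (tJ Ck Qk A S0 Pi0) y k = y k *m A.
Proof.
(* Made opaque, so that reassociating products does not look inside them. *)
clearbody y U V; case: k => // k _; rewrite /tJ block_mul_jacobi yE -mulmxA VA.
have rr l := sqrtmxP (tC_gt0 (ltn0Sn l)).
have ru l : sqrtmx (c l.+1) \in unitmx := posdefmx_unit (rr l).1.
(* The subdiagonal block cancels the square roots in [y k], leaving [U k]. *)
have -> : (if k is k'.+1 then (ta Ck Qk A S0 Pi0 k)^t* *m y k else 0) =
    invsqrtmx (c k.+1) *m ('i *: (c k.+1 *m U k)).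
  rewrite -{2}(rr k).2 -scalemxAr !mulmxA mulVmx// mul1mx.
  case: k => [|k]; first by rewrite U0 mulmx0 scaler0.
  rewrite yE -cU -{2}(rr k).2 /ta adjmxZ adjmxM rmorphN /= conjCi opprK.
  rewrite adjmxV (posdefmx_adj (rr k).1) (posdefmx_adj (rr k.+1).1).
  by rewrite -scalemxAl !mulmxA mulmxKV// mulmxKV// mulmxKV.
rewrite yE /tb /ta -/c; move: (tQ _ _ _ _ _ _) => T.
rewrite -scalemxAl /invsqrtmx !mulmxA !mulmxK//.
rewrite !mulmxDr mulmxN -!scalemxAr !mulmxA scaleNr.
by rewrite -addrA addrC.
Qed.

End Transformed.

(** * Limits of complex numbers and of complex matrices *)

Section ComplexLimits.
Context {R : realType}.
Implicit Types (T : Type).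

Lemma normr_complex_real (x : R) : `|x%:C%C| = `|x|%:C%C :> Cplx R.
Proof. by rewrite [LHS]normc_def /= expr0n addr0 sqrtr_sqr. Qed.

Lemma cvg_complex_real T (F : set_system T) {FF : Filter F} (f : T -> R)
    (l : R) : f x @[x --> F] --> l ->
  ((f x)%:C%C : Cplx R) @[x --> F] --> (l%:C%C : Cplx R).
Proof.
move=> /cvgrPdist_lt fl; apply/cvgrPdist_lt => /= e e0.
have eE : e = (complex.Re e)%:C%C by rewrite RRe_real// gtr0_real.
have Re0 : 0 < complex.Re e by rewrite -ltcR -eE.
apply: filterS (fl _ Re0) => x lfx.
by rewrite -rmorphB normr_complex_real eE ltcR.
Qed.

Lemma cvg_complex T (F : set_system T) {FF : Filter F} (f g : T -> R)
    (a b : R) :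
  f x @[x --> F] --> a -> g x @[x --> F] --> b ->
  ((f x)%:C%C + 'i * (g x)%:C%C : Cplx R) @[x --> F] -->
    (a%:C%C + 'i * b%:C%C : Cplx R).
Proof.
move=> fa gb; refine (@cvgD _ (Cplx R) _ _ _ _ _ _ _ (cvg_complex_real fa) _).
exact: cvgMr (cvg_complex_real gb).
Qed.

Lemma cvg_mx (K : numFieldType) m n T (F : set_system T) {FF : Filter F}
    (f : T -> 'M[K]_(m, n)) (L : 'M[K]_(m, n)) :
  (forall i j, f x i j @[x --> F] --> L i j) -> f x @[x --> F] --> L.
Proof.
move=> fL; apply/cvg_ballP => e e0.
have : \forall x \near F, forall i, forall j, ball (L i j) e (f x i j).
  apply: filter_forall => i; apply: filter_forall => j.
  by have /cvg_ballP := fL i j; apply.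
by apply: filterS => x fx; split.
Qed.

(** Separation is tested on entries, so that it holds for all dimensions, 0
    included. *)
Lemma mx_cvg_unique (K : numFieldType) m n T (F : set_system T)
    {FF : ProperFilter F} (f : T -> 'M[K]_(m, n)) (L L' : 'M[K]_(m, n)) :
  f x @[x --> F] --> L -> f x @[x --> F] --> L' -> L = L'.
Proof.
move=> fL fL'; apply/matrixP => i j.
have c := @coord_continuous K m n i j.
have h1 := cvg_comp _ _ fL (c L); have h2 := cvg_comp _ _ fL' (c L').
exact: (cvg_unique (@norm_hausdorff _ _) h1 h2).
Qed.

Lemma cvg_mulmx (K : numFieldType) m n p T (F : set_system T) {FF : Filter F}
    (M : 'M[K]_(m, n)) (f : T -> 'M[K]_(n, p)) (L : 'M[K]_(n, p)) :
  f x @[x --> F] --> L -> M *m f x @[x --> F] --> M *m L.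
Proof.
move=> fL; apply: cvg_mx => i j; rewrite mxE.
under eq_fun do rewrite mxE.
apply: cvg_big => [|k _]; first exact: add_continuous.
by apply: cvgMr; exact: cvg_comp _ _ fL (@coord_continuous K n p k j L).
Qed.

End ComplexLimits.

(** * Exponential generating functions *)

Section RealEgf.
Context {R : realType}.
Implicit Types (z : R^nat) (x : R).

Definition egf z x : R := limn (pseries (fun k => z k / k`!%:R) x).

Lemma egf_cvg z x : (exists M r, forall k, `|z k| <= M * r ^+ k) ->
  pseries (fun k => z k / k`!%:R) x @ \oo --> egf z x.
Proof.
move=> [M [r zr]]; apply: normed_cvg.
have expE k : M * exp_coeff (r * `|x|) k = M * r ^+ k * (`|x| ^+ k / k`!%:R).
  by rewrite /exp_coeff /= exprMn; ring.
have x0 k : 0 <= `|x| ^+ k / k`!%:R by rewrite divr_ge0 ?exprn_ge0.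
apply: (@series_le_cvg _ _ (fun k => M * exp_coeff (r * `|x|) k)) => [k|k|k|].
- exact: normr_ge0.
- by rewrite expE mulr_ge0// (le_trans _ (zr k)).
- rewrite expE (le_trans _ (ler_wpM2r (x0 k) (zr k)))//.
  by rewrite /= !normrM normrX normfV normr_nat mulrAC mulrA.
- exact/is_cvg_seriesZ/is_cvg_series_exp_coeff.
Qed.

(** Geometric bounds are stable under shifts, so that the convergence needed for
    termwise differentiation holds for the first two derived series as well. *)
Lemma egf_derive z x : (exists M r, forall k, `|z k| <= M * r ^+ k) ->
  is_derive x 1 (egf z) (egf (z \o S) x).
Proof.
move=> [M [r zr]].
have bS w : (exists M r, forall k, `|w k| <= M * r ^+ k) ->
    exists M r, forall k, `|(w \o S) k| <= M * r ^+ k.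
  move=> [M' [r' wr]]; exists (M' * r'), r' => k.
  by rewrite (le_trans (wr k.+1))// exprS mulrA.
have dE w : pseries_diffs (fun k => w k / k`!%:R) =
    (fun k => (w \o S) k / k`!%:R).
  apply/funext => k; rewrite /pseries_diffs /= factS natrM; field.
  by rewrite nat1r !pnatr_eq0 -lt0n fact_gt0.
rewrite /egf -dE; apply: (@pseries_snd_diffs _ _ (`|x| + 1)); rewrite ?dE.
- by apply/cvgP/egf_cvg; exists M, r.
- by apply/cvgP/egf_cvg/bS; exists M, r.
- by apply/cvgP/egf_cvg/bS/bS; exists M, r.
- by rewrite [ltRHS]ger0_norm ?addr_ge0// ltrDl.
Qed.

End RealEgf.

Section ComplexEgf.
Context {R : realType}.
Implicit Types (z : nat -> Cplx R) (t : R).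

(** Real and imaginary parts are summed separately because differentiation of
    power series is a statement about real series. *)
Definition cegf z t : Cplx R :=
  (egf (fun k => complex.Re (z k)) t)%:C%C +
  'i * (egf (fun k => complex.Im (z k)) t)%:C%C.

(** The ratio [r] may exceed 1: growth of this kind is beaten by factorials. *)
Definition geom_bounded z :=
  exists M r : R, forall k, `|z k| <= (M * r ^+ k)%:C%C.

Let norm_Re_le (w : Cplx R) (e : R) : `|w| <= e%:C%C -> `|complex.Re w| <= e.
Proof. by move=> we; rewrite -lecR (le_trans (normc_ge_Re w)). Qed.

Let norm_Im_le (w : Cplx R) (e : R) : `|w| <= e%:C%C -> `|complex.Im w| <= e.
Proof.
move=> we; rewrite -normrN -ReiNIm; apply: norm_Re_le.
by rewrite normrM complexiE normCi mulr1.
Qed.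

Let bounded_Re z : geom_bounded z ->
  exists M r : R, forall k, `|complex.Re (z k)| <= M * r ^+ k.
Proof. by move=> [M [r zr]]; exists M, r => k; exact: norm_Re_le. Qed.

Let bounded_Im z : geom_bounded z ->
  exists M r : R, forall k, `|complex.Im (z k)| <= M * r ^+ k.
Proof. by move=> [M [r zr]]; exists M, r => k; exact: norm_Im_le. Qed.

Let ReIm (w : Cplx R) : w = (complex.Re w)%:C%C + 'i * (complex.Im w)%:C%C.
Proof. by rewrite {1}[w]complexE complexiE. Qed.

Lemma cegf_cvg z t : geom_bounded z ->
  series (fun k => (k`!%:R)^-1 * (t%:C%C ^+ k * z k)) @ \oo --> cegf z t.
Proof.
move=> zb; rewrite (_ : series _ = fun N =>
    (pseries (fun k => complex.Re (z k) / k`!%:R) t N)%:C%C +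
    'i * (pseries (fun k => complex.Im (z k) / k`!%:R) t N)%:C%C).
  by apply: cvg_complex; apply: egf_cvg; [exact: bounded_Re|exact: bounded_Im].
apply/funext => N; rewrite /pseries /series /= !rmorph_sum mulr_sumr -big_split.
apply: eq_bigr => k _ /=; rewrite {1}[z k]ReIm !rmorphM fmorphV rmorph_nat.
by rewrite rmorphXn /=; ring.
Qed.

Lemma cegf_derive z t : geom_bounded z ->
  (s^-1)%:C%C * (cegf z (t + s) - cegf z t) @[s --> 0^'] --> cegf (z \o S) t.
Proof.
move=> zb; rewrite (_ : (fun s => _) = fun s =>
    (s^-1 * (egf (fun k => complex.Re (z k)) (t + s) -
       egf (fun k => complex.Re (z k)) t))%:C%C +
    'i * (s^-1 * (egf (fun k => complex.Im (z k)) (t + s) -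
       egf (fun k => complex.Im (z k)) t))%:C%C); last first.
  by apply/funext => s; rewrite /cegf !rmorphM !rmorphB; ring.
have dq (f : R -> R) l : is_derive t 1 f l ->
    s^-1 * (f (t + s) - f t) @[s --> 0^'] --> l.
  move=> [df <-]; rewrite (_ : (fun s => _) =
     fun s => s^-1 *: ((f \o shift t) (s *: 1) - f t)).
    exact: df.
  by apply/funext => s; rewrite /= [s *: 1]mulr1 (addrC t).
apply: cvg_complex; apply/dq.
  exact: egf_derive (bounded_Re zb).
exact: egf_derive (bounded_Im zb).
Qed.

End ComplexEgf.

(** * The matrix exponential *)

Section MatrixExponential.
Context {R : realType} {n : nat}.
Implicit Types (B : 'M[Cplx R]_n) (t : R).

Lemma exprZmx B (a : Cplx R) k : (a *: B) ^+ k = a ^+ k *: B ^+ k.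
Proof.
elim: k => [|k IH]; first by rewrite !expr0 scale1r.
by rewrite !exprS IH -!mulmxE -scalemxAl -scalemxAr scalerA.
Qed.

Lemma exprmx_geom_bounded B i j : geom_bounded (fun k => (B ^+ k) i j).
Proof.
(* The sum of all the norms of entries dominates every absolute row sum. *)
pose r : Cplx R := \sum_i \sum_j `|B i j|.
have r0 : 0 <= r by do 2 ! apply: sumr_ge0 => ? _.
exists 1, (complex.Re r) => k; rewrite mul1r rmorphXn /= RRe_real ?ger0_real//.
elim: k i j => [|k IH] i j.
  by rewrite !expr0 mxE normr_nat lern1 leq_b1.
rewrite !exprS -mulmxE mxE (le_trans (ler_norm_sum _ _ _))//.
apply: (@le_trans _ _ (\sum_l `|B i l| * r ^+ k)).
  by apply: ler_sum => l _; rewrite normrM ler_wpM2l.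
rewrite -mulr_suml ler_wpM2r ?exprn_ge0// [leRHS](bigD1 i)//= lerDl.
by do 2 ! apply: sumr_ge0 => ? _.
Qed.

Let series_entry B t N i j :
  series (fun k => (k`!%:R)^-1 *: (t%:C%C *: B) ^+ k) N i j =
  series (fun k => (k`!%:R)^-1 * (t%:C%C ^+ k * (B ^+ k) i j)) N.
Proof.
rewrite /series /= summxE; apply: eq_bigr => k _.
by rewrite exprZmx !mxE.
Qed.

Lemma expmx_cvg B t : series (fun k => (k`!%:R)^-1 *: (t%:C%C *: B) ^+ k) @ \oo
  --> \matrix_(i, j) cegf (fun k => (B ^+ k) i j) t.
Proof.
apply: cvg_mx => i j; rewrite mxE.
under eq_fun do rewrite series_entry.
exact/cegf_cvg/exprmx_geom_bounded.
Qed.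

Lemma expmxE B t :
  expmx (t%:C%C *: B) = \matrix_(i, j) cegf (fun k => (B ^+ k) i j) t.
Proof.
have c := @expmx_cvg B t.
exact: mx_cvg_unique (cvgP _ c) c.
Qed.

(** Entrywise, the derivative is the generating function of the shifted powers
    [B ^+ k.+1]; the latter is recognized as [B *m expmx _] on partial sums. *)
Lemma expmx_diff_quot B t :
  diff_quot (fun s => expmx (s%:C%C *: B)) t s @[s --> 0^']
    --> B *m expmx (t%:C%C *: B).
Proof.
have -> : B *m expmx (t%:C%C *: B) =
    \matrix_(i, j) cegf (fun k => (B ^+ k.+1) i j) t.
  have h1 : B *m series (fun k => (k`!%:R)^-1 *: (t%:C%C *: B) ^+ k) N
      @[N --> \oo] --> B *m expmx (t%:C%C *: B).
    by rewrite expmxE; exact: cvg_mulmx (@expmx_cvg B t).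
  apply: (mx_cvg_unique h1); apply: cvg_mx => i j; rewrite mxE.
  have [M [r zr]] := exprmx_geom_bounded B i j.
  rewrite (_ : (fun N => _) =
      series (fun k => (k`!%:R)^-1 * (t%:C%C ^+ k * (B ^+ k.+1) i j))).
    apply: cegf_cvg; exists (M * r), r => k.
    by rewrite -mulrA -exprS.
  apply/funext => N; rewrite /series /= mulmx_sumr summxE.
  apply: eq_bigr => k _.
  by rewrite exprZmx -!scalemxAr !mxE exprS -mulmxE mxE.
apply: cvg_mx => i j; rewrite mxE.
rewrite (_ : (fun s => _) = fun s => (s^-1)%:C%C *
    (cegf (fun k => (B ^+ k) i j) (t + s) - cegf (fun k => (B ^+ k) i j) t)).
  exact/cegf_derive/exprmx_geom_bounded.
by apply/funext => s; rewrite /diff_quot !expmxE !mxE.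
Qed.

End MatrixExponential.

(** * The dynamical system *)

Theorem theorem4p2 (R : realType) (h n : nat)
    (Ck Qk : nat -> 'M[Cplx R]_h)
    (CkQk : forall k : nat, (0 < k)%N -> Ck k *m (Qk k) ^t* = Qk k *m Ck k)
    (Ck_gt0 : forall k : nat, (0 < k)%N -> posdefmx (Ck k))
    (A S0 : 'M[Cplx R]_n) (S0_gt0 : posdefmx S0)
    (Pi0 : 'M[Cplx R]_(n, h + h))
    (AS0 : A *m S0 - S0 *m A ^t* = 'i *: (Pi0 *m jmx *m Pi0 ^t*))
    (Pi0_S0 : row_mx 1%:M (0 : 'M[Cplx R]_h) *m Pi0 ^t* *m invmx S0 = 0) :
  let Psi (t : R) (k : nat) : 'M[Cplx R]_(h, n) :=
    Yvec Ck Qk A S0 Pi0 k *m expmx (- ('i * t%:C%C) *: A) in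
  forall (t : R) (k : nat), (0 < k)%N ->
    derivablemx (fun s => Psi s k) t /\
    'i *: derivemx (fun s => Psi s k) t
      = block_mul (tJ Ck Qk A S0 Pi0) (Psi t) k.
Proof.
move=> Psi t k k0.
have PsiE s l :
    Psi s l = Yvec Ck Qk A S0 Pi0 l *m expmx (s%:C%C *: (- 'i *: A)).
  by rewrite /Psi scalerA mulrN mulrC.
have dPsi : diff_quot (fun s => Psi s k) t s @[s --> 0^'] -->
    Yvec Ck Qk A S0 Pi0 k *m (- 'i *: A *m expmx (t%:C%C *: (- 'i *: A))).
  rewrite (_ : diff_quot _ _ = fun s => Yvec Ck Qk A S0 Pi0 k *m
      diff_quot (fun s => expmx (s%:C%C *: (- 'i *: A))) t s).
    exact: cvg_mulmx (@expmx_diff_quot R n (- 'i *: A) t).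
  by apply/funext => s; rewrite /diff_quot !PsiE -scalemxAr mulmxBr.
split; first exact: cvgP dPsi.
have -> : derivemx (fun s => Psi s k) t =
    Yvec Ck Qk A S0 Pi0 k *m (- 'i *: A *m expmx (t%:C%C *: (- 'i *: A))).
  exact: mx_cvg_unique (cvgP _ dPsi) dPsi.
rewrite (_ : Psi t = fun l => Yvec Ck Qk A S0 Pi0 l *m
  expmx (t%:C%C *: (- 'i *: A))); last by apply/funext => l; exact: PsiE.
rewrite block_mul_jacobi_mulmx// block_mul_tJ//.
rewrite -scalemxAl -scalemxAr scalerA mulrN -expr2 sqrCi opprK scale1r.
by rewrite mulmxA.
Qed.
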